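(* Let $0\leq p<1$ be a real number. Let $A$ be a random binary $k \times k$ matrix for which each entry independently equals $0$ with probability $p$, and $1$ with probability $1-p$. Then $$\mathbb{P}\big(\operatorname{Per}(A)=0\big) = 2k p^k (1+o(1)) \quad\text{as } k \to \infty.$$ Moreover, the same conclusion holds if $p=p(k)\in[0,1)$ is allowed to depend on $k$, provided $k^5 p^k \rightarrow 0$ as $k\rightarrow \infty$. In particular, this holds if $p \leq 1- \frac{5 \log k+ \omega(1)}{k}$ as $k\rightarrow \infty$.
   Context: The permanent of a $k\times k$ matrix $A$ is $\operatorname{Per}(A)=\sum_{\sigma}\prod_{i=1}^{k}A_{i,\sigma(i)}$, where the sum ranges over all permutations $\sigma$ of $\{1,\dots,k\}$. A binary matrix is a matrix with entries in $\{0,1\}$. Here $\log$ is the natural logarithm and $\omega(1)$ denotes a function of $k$ tending to infinity as $k\to\infty$. *)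

(* Defs.v *)
From HB Require Import structures.
From mathcomp Require Import all_boot all_order all_algebra all_fingroup.
From mathcomp Require Import all_classical all_reals all_analysis.
Set Implicit Arguments.
Unset Strict Implicit.
Unset Printing Implicit Defensive.
Import Order.TTheory GRing.Theory Num.Theory.
Import numFieldNormedType.Exports.
Local Open Scope classical_set_scope.
Local Open Scope ring_scope.

Definition permanent (R : pzSemiRingType) (k : nat) (A : 'M[R]_k) : R :=
  \sum_(s : 'S_k) \prod_(i < k) A i (s i).

(* A binary matrix is stored as ['M[bool]_k]; this is its 0/1 matrix. *)
Definition real_mx (R : pzSemiRingType) (k : nat) (A : 'M[bool]_k) : 'M[R]_k :=
  map_mx (fun b : bool => b%:R) A.

Definition mutually_independent (R : realType) (d d' : measure_display)
    (T : measurableType d) (U : measurableType d') (P : probability T R)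
    (I : finType) (X : I -> T -> U) : Prop :=
  forall (J : {set I}) (B : I -> set U),
    (forall i, i \in J -> measurable (B i)) ->
    P (\bigcap_(i in [set` J]) X i @^-1` B i) =
    (\prod_(i in J) P (X i @^-1` B i))%E.

Record random_binary_mx (R : realType) (d : measure_display)
    (T : measurableType d) (P : probability T R) (k : nat) (p : R)
    (A : T -> 'M[bool]_k) : Prop := RandomBinaryMx {
  entry_measurable : forall i j, measurable_fun setT (fun w => A w i j);
  entry_false : forall i j, P [set w | A w i j = false] = p%:E;
  entry_true : forall i j, P [set w | A w i j = true] = (1 - p)%:E;
  entry_independent :
    mutually_independent P (fun (ij : 'I_k * 'I_k) w => A w ij.1 ij.2)
}.

(* [eps] is the o(1) term; the multiplicative form is used rather than a
   quotient tending to 1 because [p k] may be 0. *)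
Definition permanent_zero_asymptotics (R : realType)
    (d : nat -> measure_display) (T : forall k, measurableType (d k))
    (P : forall k, probability (T k) R) (A : forall k, T k -> 'M[bool]_k)
    (p : nat -> R) : Prop :=
  exists eps : nat -> R, eps k @[k --> \oo] --> 0 /\
    \forall k \near \oo,
      P k [set w | permanent (real_mx R (A k w)) = 0] =
      (2 * k%:R * p k ^+ k * (1 + eps k))%:E.

(* Main.v *)
Require Import Defs.
From HB Require Import structures.
From mathcomp Require Import all_boot all_order all_algebra all_fingroup.
From mathcomp Require Import all_classical all_reals all_analysis.
From mathcomp Require Import zify ring lra.
Set Implicit Arguments.
Unset Strict Implicit.
Unset Printing Implicit Defensive.
Import Order.TTheory GRing.Theory Num.Theory.
Import numFieldNormedType.Exports.
Local Open Scope classical_set_scope.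
Local Open Scope ring_scope.

(** By the Frobenius-Konig theorem, the permanent of a 0/1 matrix of size [k]
    vanishes exactly when some [a] rows and [b] columns with [a + b = k + 1]
    meet in zeros only.  A given [a x b] block vanishes with probability
    [p ^ (a * b)].  The cheapest blocks are the [2 k] lines, i.e. the full rows
    and the full columns, which cost [p ^ k] each; the theorem says that all
    the other obstructions together are negligible.

    Upper bound ([prob_per0_le], [block_sum_le]): the union bound over all
    blocks gives the sum over [a] of [C(k,a) C(k,b) p^(ab)] with
    [b = k + 1 - a].  The extreme terms [a = 1] and [a = k] contribute
    [2 k p^k].  Put [a = a' + 1] and [b = b' + 1], and suppose [a' <= b'], as
    symmetry permits.  Since [ab = k + a'b'], and since [a' + b' = k - 1]
    makes [2 b' >= k - 1], the term is at most [k p^k x^a'] with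
    [x = k^2 (sqrt p)^(k-1)].  Hence the middle terms add up to [k p^k]
    times two geometric series without constant term, which is [O(k p^k x)].

    Lower bound ([prob_per0_ge]): by the second Bonferroni inequality, the
    probability that some line vanishes is at least [2 k p^k] minus
    [C(2k,2) p^(2k-1)], because two distinct lines share at most one entry.
    That error is again [O(k p^k x)].

    Together, the relative error is at most [2 x] once [x <= 1/2]
    ([prob_per0_approx]).  Finally [x ^ 2 = k^4 p^(k-1)] tends to [0] as
    soon as [k^5 p^k] does ([cvg_ratio0]).  The case of a constant [p] and the
    case [p <= 1 - (5 log k + omega) / k] reduce to this hypothesis through
    [1 + y <= exp y]. *)

(** * Hall's marriage theorem and the Frobenius-Konig theorem *)

Section Hall.
Variables (T U : finType) (r : T -> U -> bool) (u0 : U).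
Implicit Types (S : {set T}) (C : {set U}).

Definition nbhd S C : {set U} := [set y in C | [exists x in S, r x y]].

Lemma nbhdP S C y :
  reflect (y \in C /\ exists2 x, x \in S & r x y) (y \in nbhd S C).
Proof.
rewrite inE; apply: (iffP andP) => -[yC].
  by case/existsP => x /andP[xS rxy]; split=> //; exists x.
by case=> x xS rxy; split=> //; apply/existsP; exists x; rewrite xS.
Qed.

Definition matching S C (f : T -> U) :=
  {in S &, injective f} /\ {in S, forall x, f x \in C /\ r x (f x)}.

(** Both steps of the induction for Hall's theorem use this: the second
    matching avoids [C1], so it cannot collide with the first one. *)
Lemma matching_glue S1 S C1 C f1 f2 : C1 \subset C ->
  matching S1 C1 f1 -> matching (S :\: S1) (C :\: C1) f2 ->
  matching S C (fun x => if x \in S1 then f1 x else f2 x).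
Proof.
move=> /fintype.subsetP sC [inj1 m1] [inj2 m2].
have{} m2 x : x \in S -> x \notin S1 ->
    [/\ f2 x \in C, f2 x \notin C1 & r x (f2 x)].
  move=> xS xS1; have [|/setDP[-> ->] ->//] := m2 x.
  by rewrite inE xS1.
split=> [x y xS yS|x xS].
  case: ifPn => xS1; case: ifPn => yS1.
  - exact: inj1.
  - by have [h _] := m1 _ xS1 => e; have [_] := m2 _ yS yS1; rewrite -e h.
  - by have [h _] := m1 _ yS1 => e; have [_] := m2 _ xS xS1; rewrite e h.
  - by apply: inj2; rewrite inE ?xS1 ?yS1.
case: ifPn => xS1; first by have [/sC -> ->] := m1 _ xS1.
by have [-> _ ->] := m2 _ xS xS1.
Qed.

(** Induction on [#|S|], following Halmos and Vaughan.  If some nonempty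
    proper subset is tight, i.e. has exactly as many neighbours as elements,
    then it is matched into its neighbourhood, and the rest inherits Hall's
    condition outside of that neighbourhood.  Otherwise every nonempty proper
    subset has a spare neighbour, so any edge may be chosen and both of
    its ends removed without breaking Hall's condition.  The set [C] of allowed
    partners is a parameter because both cases shrink it.  The point [u0] is
    only a value for the empty matching. *)
Lemma hall_marriage S C :
  (forall S', S' \subset S -> (#|S'| <= #|nbhd S' C|)%N) ->
  exists f, matching S C f.
Proof.
have [n] := ubnP #|S|; elim: n S C => // n IHn S C; rewrite ltnS => leSn hallS.
have [->|/set0Pn[x xS]] := eqVneq S finset.set0.
  by exists (fun=> u0); split=> [? ?|?]; rewrite inE.
have [/existsP[S' /and3P[pS' nzS' /eqP eqS']]|noTight] :=
  boolP [exists S' : {set T}, [&& S' \proper S, S' != finset.set0 &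
           #|nbhd S' C| == #|S'|]].
- have sS'S := proper_sub pS'.
  have ltS'S := proper_card pS'.
  have [|S2 sS2|f1 m1] := IHn S' (nbhd S' C); first exact: leq_trans leSn.
    apply: leq_trans (hallS _ (fintype.subset_trans sS2 sS'S)) _.
    apply/subset_leq_card/fintype.subsetP => y /nbhdP[yC [z zS2 rzy]].
    apply/nbhdP; split; last by exists z.
    by apply/nbhdP; split=> //; exists z => //; apply: (fintype.subsetP sS2).
  have ltD : (#|S :\: S'| < n)%N.
    rewrite cardsDS //; apply: leq_trans leSn.
    by rewrite ltn_subrL !lt0n !cards_eq0 nzS'; apply/set0Pn; exists x.
  have [S2 sS2|f2 m2] := IHn (S :\: S') (C :\: nbhd S' C) ltD.
    have dS : S2 :&: S' = finset.set0.
      apply/finset.setP => z; rewrite !inE; apply/negbTE/negP => /andP[zS2 zS'].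
      by have := fintype.subsetP sS2 z zS2; rewrite inE zS'.
    have sU : S2 :|: S' \subset S.
      rewrite finset.subUset sS'S andbT.
      exact: (fintype.subset_trans sS2 (finset.subsetDl _ _)).
    (* Hall's condition for S2 :|: S', minus the tight equality for S'. *)
    rewrite -(leq_add2r #|S'|).
    have -> : (#|S2| + #|S'|)%N = #|S2 :|: S'|.
      by rewrite cardsU dS cards0 subn0.
    rewrite -eqS'.
    apply: leq_trans (hallS _ sU) _; rewrite -cardsUI.
    apply: leq_trans (leq_addr _ _); apply/subset_leq_card/fintype.subsetP => y.
    case/nbhdP => yC [z /finset.setUP[zS2|zS'] rzy]; apply/finset.setUP.
      have [|nyN] := boolP (y \in nbhd S' C); [by right|left].
      by apply/nbhdP; split; [rewrite inE nyN | exists z].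
    by right; apply/nbhdP; split=> //; exists z.
  have sN : nbhd S' C \subset C by apply/fintype.subsetP => y /nbhdP[].
  by exists (fun z => if z \in S' then f1 z else f2 z);
     apply: matching_glue m1 m2.
have surplus S' : S' \proper S -> S' != finset.set0 -> (#|S'| < #|nbhd S' C|)%N.
  move=> pS' nz; rewrite ltn_neqAle hallS ?proper_sub // andbT eq_sym.
  by apply: contra noTight => e; apply/existsP; exists S'; rewrite pS' nz.
have /card_gt0P[y /nbhdP[yC [w /finset.set1P-> rxy]]] :
    (0 < #|nbhd [set x]%SET C|)%N.
  by apply: leq_trans (hallS _ _); rewrite ?cards1 // finset.sub1set.
have m1 : matching [set x]%SET [set y]%SET (fun=> y).
  split=> [? ? /finset.set1P-> /finset.set1P->//|? /finset.set1P->].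
  by rewrite finset.set11.
have [||f2 m2] := IHn (S :\ x) (C :\ y).
- by apply: leq_trans leSn; rewrite [X in (_ < X)%N](cardsD1 x) xS.
- move=> S' sS'; have [->|nz] := eqVneq S' finset.set0; first by rewrite cards0.
  have pS' : S' \proper S.
    by apply: fintype.sub_proper_trans sS' _; rewrite properD1.
  rewrite -ltnS; apply: leq_trans (surplus _ pS' nz) _.
  rewrite (cardsD1 y) -add1n leq_add ?leq_b1 // subset_leq_card //.
  apply/fintype.subsetP => z /setD1P[zy /nbhdP[zC [v vS rvz]]].
  by apply/nbhdP; split; [rewrite !inE zy | exists v].
exists (fun z => if z \in [set x]%SET then y else f2 z).
by apply: matching_glue m1 m2; rewrite finset.sub1set.
Qed.

End Hall.

Lemma exists_subset_card (T : finType) (B : {set T}) n :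
  (n <= #|B|)%N -> exists2 B' : {set T}, B' \subset B & #|B'| = n.
Proof.
move=> leB; exists [set x in take n (enum B)]%SET.
  by apply/fintype.subsetP => x; rewrite inE => /mem_take; rewrite mem_enum.
by rewrite cardsE (card_uniqP _) ?take_uniq ?enum_uniq // size_takel -?cardE.
Qed.

Definition zero_block k (M : 'M[bool]_k) (I J : {set 'I_k}) :=
  forall i j, i \in I -> j \in J -> M i j = false.

(** All the terms of the permanent are nonnegative, so nothing cancels. *)
Lemma permanent_eq0 (R : numDomainType) k (M : 'M[bool]_k) :
  permanent (real_mx R M) = 0 <-> forall s : 'S_k, exists i, M i (s i) = false.
Proof.
have term_ge0 (s : 'S_k) : true -> 0 <= \prod_(i < k) real_mx R M i (s i).
  by move=> _; apply: prodr_ge0 => i _; rewrite mxE ler0n.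
split=> [/eqP|noPM].
  rewrite /permanent psumr_eq0 // => /allP all0 s.
  have /implyP/(_ isT) := all0 s (mem_index_enum _).
  rewrite prodf_seq_eq0 => /hasP[i _] /=.
  rewrite mxE pnatr_eq0 eqb0 => /negbTE e.
  by exists i.
apply: big1 => s _; have [i e] := noPM s.
by rewrite (bigD1 i) //= mxE e mul0r.
Qed.

(** If no permutation avoids the zeros, then Hall's condition fails for some
    set [I] of rows, and these rows vanish on more than [k - #|I|] columns.
    Conversely, a permutation avoiding the zeros would inject [I] into the
    complement of [J], which has only [#|I| - 1] elements. *)
Lemma frobenius_konig (R : numDomainType) k (M : 'M[bool]_k) :
  permanent (real_mx R M) = 0 <->
  exists I J : {set 'I_k}, (#|I| + #|J|)%N = k.+1 /\ zero_block M I J.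
Proof.
rewrite permanent_eq0; split=> [noPM|[I [J [cIJ zIJ]]] s]; last first.
  have [/existsP[i /andP[iI siJ]]|h] :=
      boolP [exists i, (i \in I) && (s i \in J)].
    by exists i; apply: zIJ.
  have : (#|I| <= #|~: J|)%N.
    rewrite -(card_imset _ (@perm_inj _ s)); apply/subset_leq_card.
    apply/fintype.subsetP => _ /imsetP[i iI ->]; rewrite inE.
    by apply: contra h => siJ; apply/existsP; exists i; rewrite iI.
  by rewrite (cardsCs (~: J)) finset.setCK card_ord; have := max_card J;
     rewrite card_ord; lia.
(* A size of at least 1 provides the default column for Hall's theorem. *)
case: k M noPM => [M noPM|k M noPM]; first by have [[]] := noPM 1%g.
have [/existsP[I ltI]|noI] := boolP
    [exists I : {set 'I_k.+1}, (#|nbhd M I finset.setT| < #|I|)%N].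
  have [|J sJ cJ] :=
      @exists_subset_card _ (~: nbhd M I finset.setT) (k.+2 - #|I|).
    by rewrite (cardsCs (~: _)) finset.setCK card_ord; lia.
  exists I, J; split.
    by rewrite cJ subnKC //; apply: leq_trans (max_card I) _; rewrite card_ord.
  move=> i j iI /(fintype.subsetP sJ); rewrite inE => jN.
  by apply: contraNF jN => Mij; apply/nbhdP; split; rewrite ?inE //; exists i.
have [S' _|f [injf mf]] :=
    @hall_marriage _ _ (fun i j => M i j) ord0 finset.setT finset.setT.
  by rewrite leqNgt; apply: contra noI => h; apply/existsP; exists S'.
have inj : injective f by move=> i j; apply: injf; rewrite inE.
have [i] := noPM (perm inj); rewrite permE.
by have [|_ ->] := mf i; rewrite ?inE.
Qed.

(** * The sum of block probabilities *)

Lemma bin_le_expn n m : ('C(n, m) <= n ^ m)%N.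
Proof.
apply: (@leq_trans (n ^_ m)); first by rewrite -bin_ffact leq_pmulr ?fact_gt0.
elim: m => [|m IHm]; first by rewrite ffactn0 expn0.
by rewrite ffactnSr expnSr leq_mul // leq_subr.
Qed.

Lemma card_card_eq k a :
  #|(fun I : {set 'I_k} => #|I| == a)| = 'C(k, a).
Proof. by rewrite -cardsE card_draws card_ord. Qed.

Lemma sum_card_set (V : nmodType) k (f : nat -> V) :
  \sum_(I : {set 'I_k}) f #|I| = \sum_(a < k.+1) f a *+ 'C(k, a).
Proof.
have ltI (I : {set 'I_k}) : (#|I| < k.+1)%N.
  by rewrite ltnS -[X in (_ <= X)%N]card_ord max_card.
rewrite (partition_big (fun I => Ordinal (ltI I)) xpredT) //=.
apply: eq_bigr => a _; rewrite (eq_bigr (fun=> f a)) => [|I /eqP<-//].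
by rewrite sumr_const card_card_eq.
Qed.

Section BlockSum.
Variables (R : realType) (q : R).
Hypotheses (q_ge0 : 0 <= q) (q_le1 : q <= 1).

(** The union bound over blocks, sorted by the number [a] of rows.  The term
    [a = 0] vanishes: it carries the binomial [C(k, k + 1) = 0]. *)
Lemma block_sumE k :
  \sum_(IJ : {set 'I_k} * {set 'I_k} | (#|IJ.1| + #|IJ.2|)%N == k.+1)
     q ^+ (#|IJ.1| * #|IJ.2|) =
  \sum_(a < k.+1) q ^+ (a * (k.+1 - a)) *+ 'C(k, k.+1 - a) *+ 'C(k, a).
Proof.
transitivity (\sum_(I : {set 'I_k})
    \sum_(J : {set 'I_k} | (#|I| + #|J|)%N == k.+1) q ^+ (#|I| * #|J|)).
  by rewrite pair_big_dep.
rewrite -(sum_card_set k (fun a => q ^+ (a * (k.+1 - a)) *+ 'C(k, k.+1 - a))).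
apply: eq_bigr => I _.
have leI : (#|I| <= k)%N by rewrite -[X in (_ <= X)%N]card_ord max_card.
rewrite (eq_bigl (fun J : {set 'I_k} => #|J| == (k.+1 - #|I|)%N)); last first.
  by move=> J; rewrite -[RHS](eqn_add2l #|I|) subnKC // leqW.
rewrite (eq_bigr (fun=> q ^+ (#|I| * (k.+1 - #|I|)))) => [|J /eqP->//].
by rewrite sumr_const card_card_eq.
Qed.

(** Here the block has [a + 1] rows and [b + 1] columns, and the zero
    probability is written [q ^ 2] so that [x = k^2 q^(k-1)] needs no root.
    Its excess exponent over a line is [(a+1)(b+1) - k = a b], and
    [2 a b >= a (k - 1)] as [b] is the larger of two numbers with sum [k - 1].
    The number of blocks is at most [k^(a+1) k^a] since [b + 1 = k - a]. *)
Lemma block_term_le k a b : (a <= b)%N -> (a + b).+1 = k ->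
  q ^+ 2 ^+ (a.+1 * b.+1) *+ ('C(k, a.+1) * 'C(k, b.+1)) <=
  k%:R * q ^+ 2 ^+ k * (k%:R ^+ 2 * q ^+ k.-1) ^+ a.
Proof.
move=> leab <- /=; set k' := (a + b).+1.
have -> : (a.+1 * b.+1 = k' + a * b)%N by rewrite /k'; lia.
have leC : ('C(k', a.+1) * 'C(k', b.+1) <= k' * (k' ^ 2) ^ a)%N.
  have -> : 'C(k', b.+1) = 'C(k', a).
    by rewrite -bin_sub /k' ?ltnS ?leq_addl //; congr 'C(_, _); lia.
  rewrite -expnM mul2n -addnn expnD mulnA -expnS.
  by apply: leq_mul; apply: bin_le_expn.
have -> : k'%:R * q ^+ 2 ^+ k' * (k'%:R ^+ 2 * q ^+ (a + b)) ^+ a =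
    (k' * (k' ^ 2) ^ a)%:R * (q ^+ 2 ^+ k' * q ^+ (a + b) ^+ a).
  by rewrite natrM !natrX [(_ * q ^+ (a + b)) ^+ a]exprMn mulrACA.
rewrite -mulr_natl; apply: ler_pM; rewrite ?ler0n ?exprn_ge0 ?ler_nat //.
rewrite exprD ler_wpM2l ?exprn_ge0 // -!exprM ler_wiXn2l //.
by rewrite /k'; nia.
Qed.

Lemma geometric_tail_le (x : R) n : 0 <= x <= 2^-1 ->
  \sum_(i < n) x ^+ i.+1 <= 2 * x.
Proof.
case/andP=> x0 x2; under eq_bigr do rewrite exprS.
rewrite -mulr_sumr mulrC ler_wpM2r //.
have := subrX1 x n; have : 0 <= x ^+ n by rewrite exprn_ge0.
have : 0 <= \sum_(i < n) x ^+ i by apply: sumr_ge0 => i _; rewrite exprn_ge0.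
by nra.
Qed.

(** The first and the last terms are the rows and the columns.  The other
    terms are not compared with [x ^ minn a b] but with the sum of both powers,
    which spares cutting the range in two halves. *)
Lemma block_sum_le k : (1 < k)%N ->
  let x := k%:R ^+ 2 * q ^+ k.-1 in x <= 2^-1 ->
  \sum_(a < k.+1) q ^+ 2 ^+ (a * (k.+1 - a)) *+ 'C(k, k.+1 - a) *+ 'C(k, a) <=
  2 * k%:R * q ^+ 2 ^+ k * (1 + 2 * x).
Proof.
case: k => [//|[//|n _]] x x2; set k := n.+2.
have x0 : 0 <= x by rewrite mulr_ge0 ?exprn_ge0.
rewrite big_ord_recl big_ord_recl big_ord_recr /=.
rewrite subn0 bin_small // mulr0n mul0rn add0r /bump /=.
under eq_bigr do rewrite !add1n.
rewrite addn0 !add1n subSS subSnn subn0 mul1n muln1 binn !bin1 !mulr1n.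
have middle : \sum_(i < n) q ^+ 2 ^+ (i.+2 * (k.+1 - i.+2)) *+
    'C(k, k.+1 - i.+2) *+ 'C(k, i.+2) <=
  \sum_(i < n) k%:R * q ^+ 2 ^+ k * (x ^+ i.+1 + x ^+ (n - i)).
  apply: ler_sum => i _.
  have -> : (k.+1 - i.+2 = (n - i).+1)%N by rewrite /k; have := ltn_ord i; lia.
  have kE : (i.+1 + (n - i)).+1 = k by rewrite /k; have := ltn_ord i; lia.
  have C0 : 0 <= k%:R * q ^+ 2 ^+ k by rewrite mulr_ge0 ?exprn_ge0.
  rewrite -mulrnA; case: (leqP i.+1 (n - i)) => [le_in|/ltnW le_ni].
    rewrite [X in _ *+ X]mulnC; apply: le_trans (block_term_le le_in kE) _.
    by rewrite ler_wpM2l // lerDl exprn_ge0.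
  rewrite addnC in kE; rewrite [(i.+2 * _)%N]mulnC.
  apply: le_trans (block_term_le le_ni kE) _.
  by rewrite ler_wpM2l // lerDr exprn_ge0.
have tail := @geometric_tail_le x n; rewrite x0 x2 in tail.
have {}tail := tail isT.
have tail' : \sum_(i < n) x ^+ (n - i) = \sum_(i < n) x ^+ i.+1.
  rewrite (reindex_inj rev_ord_inj); apply: eq_bigr => i _ /=.
  by rewrite subKn // ltn_ord.
move: middle; rewrite -mulr_sumr big_split /= tail' => middle.
have C0 : 0 <= k%:R * q ^+ 2 ^+ k by rewrite mulr_ge0 ?exprn_ge0.
rewrite -mulr_natl.
set S := \sum_(i < n) x ^+ i.+1 in middle tail.
set M := \sum_(i < n) _ in middle *.
set c := k%:R * q ^+ 2 ^+ k in middle C0 *.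
have -> : 2 * k%:R * q ^+ 2 ^+ k = 2 * c by rewrite /c mulrA.
by nra.
Qed.
End BlockSum.

(** * Bounds on the probability of a finite union *)

Section FiniteUnions.
Context (R : realType) (d : measure_display) (T : measurableType d).
Variables (P : probability T R).

Lemma union_bound (I : Type) (E : I -> set T) (s : seq I) :
  (forall i, measurable (E i)) ->
  (P (\big[setU/set0]_(i <- s) E i) <= \sum_(i <- s) P (E i))%E.
Proof.
move=> mE; elim: s => [|i s IHs]; first by rewrite !big_nil measure0.
rewrite !big_cons; apply: le_trans (leeD2l _ IHs).
by apply: measureU2 => //; exact: bigsetU_measurable.
Qed.

(** Each new event overlaps the union of the [n] former ones in probability
    at most [n c], and these losses sum to ['C(n, 2) c]. *)
Lemma bonferroni_lower (I : eqType) (E : I -> set T) (q c : R) (s : seq I) :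
  (forall i, measurable (E i)) -> uniq s ->
  (forall i, i \in s -> P (E i) = q%:E) ->
  (forall i j, i \in s -> j \in s -> i != j -> (P (E i `&` E j) <= c%:E)%E) ->
  (((size s)%:R * q - 'C(size s, 2)%:R * c)%:E <=
     P (\big[setU/set0]_(i <- s) E i))%E.
Proof.
move=> mE; elim: s => [|i s IHs] /=.
  by rewrite big_nil measure0 !mul0r subr0.
case/andP => iNs us Pq Pc; rewrite big_cons.
set F := \big[setU/set0]_(j <- s) E j.
have mF : measurable F by exact: bigsetU_measurable.
have PFoo : (P F < +oo)%E by rewrite ltey_eq fin_num_measure.
have -> : P (E i `|` F) = (P (E i) + P F - P (E i `&` F))%E.
  exact: measureUfinr.
have lePF : (((size s)%:R * q - 'C(size s, 2)%:R * c)%:E <= P F)%E.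
  by apply: IHs => // [j js|j l js ls]; [apply: Pq|apply: Pc];
     rewrite inE ?js ?ls orbT.
have overlap : (P (E i `&` F) <= ((size s)%:R * c)%:E)%E.
  rewrite /F big_distrr /=.
  have mEE j : measurable (E i `&` E j) by exact: measurableI.
  apply: le_trans (union_bound s mEE) _.
  have -> : ((size s)%:R * c)%:E = (\sum_(j <- s) c%:E)%E.
    by rewrite sumEFin big_const_seq count_predT iter_addr_0 mulr_natl.
  rewrite big_seq [leRHS]big_seq; apply: lee_sum => j js.
  apply: Pc; rewrite ?mem_head ?inE ?js ?orbT //.
  by apply: contraNneq iNs => ->.
rewrite Pq ?mem_head //.
apply: (@le_trans _ _ (q%:E + ((size s)%:R * q - 'C(size s, 2)%:R * c)%:E
                       - ((size s)%:R * c)%:E)%E); last first.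
  by apply: leeB => //; apply: leeD.
rewrite -!EFinD lee_fin /= binS bin1 natrD -natr1.
by rewrite le_eqVlt; apply/orP; left; apply/eqP; ring.
Qed.
End FiniteUnions.

(** * Vanishing sets of entries *)

Section ZeroEntries.
Context (R : realType) (d : measure_display) (T : measurableType d).
Variables (P : probability T R) (k : nat) (p : R) (A : T -> 'M[bool]_k).
Hypothesis randA : random_binary_mx P p A.

Definition zero_on (J : {set 'I_k * 'I_k}) : set T :=
  [set w | forall ij, ij \in J -> A w ij.1 ij.2 = false].

Lemma zero_onE J : zero_on J =
  \bigcap_(ij in [set` J]) (fun w => A w ij.1 ij.2) @^-1` [set false].
Proof. by apply/seteqP; split=> w /= h ij /h. Qed.

Lemma measurable_zero_on J : measurable (zero_on J).
Proof.
rewrite zero_onE; apply: fin_bigcap_measurable; first exact: finite_finset.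
move=> ij _; rewrite -[X in measurable X]setTI.
exact: (entry_measurable randA).
Qed.

Lemma prob_zero_on J : P (zero_on J) = (p ^+ #|J|)%:E.
Proof.
rewrite zero_onE (entry_independent randA) => [|//].
rewrite (eq_bigr (fun=> p%:E)) => [|ij _]; last exact: (entry_false randA).
by rewrite prodEFin prodr_const.
Qed.

Lemma zero_onU J1 J2 : zero_on J1 `&` zero_on J2 = zero_on (J1 :|: J2).
Proof.
apply/seteqP; split=> w /=.
  by move=> [h1 h2] ij; rewrite inE => /orP[/h1|/h2].
by move=> h; split=> ij h'; apply: h; rewrite inE h' ?orbT.
Qed.
End ZeroEntries.

(** * The probability that the permanent vanishes *)

Section PermanentZero.
Context (R : realType) (d : measure_display) (T : measurableType d).
Variables (P : probability T R) (k : nat) (p : R) (A : T -> 'M[bool]_k).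
Hypothesis randA : random_binary_mx P p A.
Hypotheses (p_ge0 : 0 <= p) (p_le1 : p <= 1).

Definition per0_event : set T :=
  [set w | permanent (real_mx R (A w)) = 0].

Definition blocks : seq ({set 'I_k} * {set 'I_k}) :=
  [seq IJ : {set 'I_k} * {set 'I_k} <- index_enum _ |
     (#|IJ.1| + #|IJ.2|)%N == k.+1].

Lemma per0_eventE : per0_event =
  \big[setU/set0]_(IJ <- blocks) zero_on A (finset.setX IJ.1 IJ.2).
Proof.
rewrite -bigcup_seq; apply/seteqP; split=> w.
  move/frobenius_konig => [I [J [cIJ zIJ]]]; exists (I, J) => /=.
    by rewrite mem_filter mem_index_enum andbT /= cIJ.
  by case=> i j; rewrite finset.in_setX => /andP[/= iI jJ]; apply: zIJ.
case=> -[I J] /=; rewrite mem_filter => /andP[/= /eqP cIJ _] zIJ.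
apply/frobenius_konig; exists I, J; split=> // i j iI jJ.
by have := zIJ (i, j); rewrite finset.in_setX iI jJ; apply.
Qed.

Lemma measurable_per0_event : measurable per0_event.
Proof.
rewrite per0_eventE; apply: bigsetU_measurable => IJ _.
exact: (measurable_zero_on randA).
Qed.

Lemma prob_per0_le : (P per0_event <=
  (\sum_(a < k.+1) p ^+ (a * (k.+1 - a)) *+ 'C(k, k.+1 - a) *+ 'C(k, a))%:E)%E.
Proof.
rewrite per0_eventE -block_sumE -sumEFin -[leRHS]big_filter -/blocks.
have mZ (IJ : {set 'I_k} * {set 'I_k}) :
    measurable (zero_on A (finset.setX IJ.1 IJ.2)).
  exact: (measurable_zero_on randA).
apply: le_trans (union_bound P blocks mZ) _.
by apply: lee_sum => IJ _; rewrite (prob_zero_on randA) cardsX.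
Qed.

(** Rows and columns are indexed by one type so that a single Bonferroni
    inequality covers all of them. *)
Definition line (l : bool * 'I_k) : {set 'I_k * 'I_k} :=
  if l.1 then finset.setX [set l.2]%SET finset.setT
  else finset.setX finset.setT [set l.2]%SET.

Lemma in_line l ij : (ij \in line l) = ((if l.1 then ij.1 else ij.2) == l.2).
Proof. by rewrite /line; case: l ij => -[] l [i j]; rewrite !inE ?andbT. Qed.

Lemma card_line l : #|line l| = k.
Proof.
rewrite /line; case: l => -[] l; rewrite cardsX cards1 cardsT card_ord.
  by rewrite mul1n.
by rewrite muln1.
Qed.

(** Two distinct lines share at most one entry. *)
Lemma card_lineU l l' : l != l' -> (k.*2.-1 <= #|line l :|: line l'|)%N.
Proof.
move=> nll; rewrite cardsU !card_line addnn -subn1 leq_sub2l //.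
apply/card_le1_eqP => -[i j] [i' j']; rewrite !inE !in_line.
case: l l' nll => -[] l [[] l'] nll /=
  /andP[/eqP e1 /eqP e2] /andP[/eqP e3 /eqP e4].
- by rewrite -e1 -e2 eqxx in nll.
- by rewrite e1 e2 e3 e4.
- by rewrite e1 e2 e3 e4.
- by rewrite -e1 -e2 eqxx in nll.
Qed.

Lemma lines_sub_per0 :
  \big[setU/set0]_(l <- enum {: bool * 'I_k}) zero_on A (line l)
  `<=` per0_event.
Proof.
rewrite -bigcup_seq => w [[[] l] _ /= zl]; apply/frobenius_konig.
  exists [set l]%SET, finset.setT; rewrite cards1 cardsT card_ord; split=> //.
  by move=> i j /finset.set1P-> _; apply: (zl (_, _)); rewrite in_line /=.
exists finset.setT, [set l]%SET.
rewrite cards1 cardsT card_ord addn1; split=> //.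
by move=> i j _ /finset.set1P->; apply: (zl (_, _)); rewrite in_line /=.
Qed.

Lemma prob_per0_ge :
  (((2 * k)%:R * p ^+ k - 'C(2 * k, 2)%:R * p ^+ k.*2.-1)%:E <=
     P per0_event)%E.
Proof.
have mZ l : measurable (zero_on A (line l)).
  exact: (measurable_zero_on randA).
have := @bonferroni_lower _ _ _ P _ (fun l => zero_on A (line l)) (p ^+ k)
  (p ^+ k.*2.-1) (enum {: bool * 'I_k}) mZ (enum_uniq _).
rewrite -cardE card_prod card_bool card_ord.
move=> bonf; apply: le_trans (bonf _ _) _.
- by move=> l _; rewrite (prob_zero_on randA) card_line.
- move=> l l' _ _ nll; rewrite zero_onU (prob_zero_on randA) lee_fin.
  by rewrite ler_wiXn2l // card_lineU.
apply: le_measure; rewrite ?inE; last exact: lines_sub_per0.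
  exact: bigsetU_measurable.
exact: measurable_per0_event.
Qed.

(** Both errors are measured in units of the main term: the upper bound
    exceeds it by the factor [1 + 2 x], and the Bonferroni loss is at most
    [2 k^2 p^(2k-1) = 2 k p^k * (k p^(k-1))], where [k p^(k-1) <= x]. *)
Lemma prob_per0_approx : (1 < k)%N ->
  let x := k%:R ^+ 2 * Num.sqrt p ^+ k.-1 in x <= 2^-1 ->
  `|fine (P per0_event) - 2 * k%:R * p ^+ k| <= 2 * k%:R * p ^+ k * (2 * x).
Proof.
move=> k1 x x2.
have q0 := sqrtr_ge0 p.
have q1 : Num.sqrt p <= 1 by rewrite -sqrtr1 ler_sqrt.
have up := prob_per0_le; have lo := prob_per0_ge.
have x0 : 0 <= x by rewrite mulr_ge0 ?exprn_ge0.
have fP : P per0_event \is a fin_num.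
  by apply: fin_num_measure; exact: measurable_per0_event.
rewrite -(fineK fP) !lee_fin in up lo.
set f := fine _ in up lo *.
have := block_sum_le q0 q1 k1 x2; rewrite !sqr_sqrtr // -/x => up2.
have {up up2}up := le_trans up up2.
have kx : k%:R * p ^+ k.-1 <= x.
  rewrite /x; apply: ler_pM; rewrite ?exprn_ge0 //.
    by rewrite expr2 ler_peMr ?ler0n // ler1n ltnW.
  rewrite -{1}(sqr_sqrtr p_ge0) -exprM ler_wiXn2l //.
  by rewrite mul2n -addnn leq_addr.
have pE : p ^+ k.*2.-1 = p ^+ k * p ^+ k.-1.
  by rewrite -exprD; congr (_ ^+ _); lia.
have binE : 'C(2 * k, 2)%:R <= 2 * k%:R * k%:R :> R.
  rewrite -!natrM ler_nat bin2; lia.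
have C0 : 0 <= k%:R * p ^+ k by rewrite mulr_ge0 ?exprn_ge0.
have pk0 : 0 <= p ^+ k * p ^+ k.-1 by rewrite mulr_ge0 ?exprn_ge0.
have lo2 : 'C(2 * k, 2)%:R * p ^+ k.*2.-1 <= 2 * k%:R * p ^+ k * x.
  rewrite pE; apply: le_trans (ler_wpM2r pk0 binE) _.
  have -> : 2 * k%:R * k%:R * (p ^+ k * p ^+ k.-1) =
    2 * k%:R * p ^+ k * (k%:R * p ^+ k.-1) by ring.
  by rewrite ler_wpM2l // -mulrA mulr_ge0.
have cE : 2 * k%:R * p ^+ k = 2 * (k%:R * p ^+ k) by rewrite mulrA.
rewrite natrM in lo; rewrite !cE in up lo lo2 *.
set c := k%:R * p ^+ k in up lo lo2 C0 *.
set C := 'C(_, _)%:R * _ in lo lo2.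
have cx0 : 0 <= c * x by rewrite mulr_ge0.
rewrite ler_distl; apply/andP; split; lra.
Qed.
End PermanentZero.

(** * Asymptotics *)

(** This is [1 - y <= exp (- y)] at [y = c / k], raised to the power [k]. *)
Lemma exprn_le_expR (R : realType) (z c : R) k :
  0 <= z -> z <= 1 - c / k%:R -> (0 < k)%N -> z ^+ k <= expR (- c).
Proof.
move=> z0 zc k0.
have -> : - c = k%:R * (- (c / k%:R)).
  by rewrite mulrN mulrCA divff ?mulr1 // pnatr_eq0 -lt0n.
rewrite expRM_natl; apply: lerXn2r; rewrite ?nnegrE ?expR_ge0 //.
by apply: le_trans zc _; apply: expR_ge1Dx.
Qed.

(** With [c = 1 - z], the bound [z^k <= exp (- k c)] and the term of order
    [n + 1] of the exponential series leave a multiple of [1 / k]. *)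
Lemma cvg_natX_exprn0 (R : realType) (n : nat) (z : R) : 0 <= z < 1 ->
  k%:R ^+ n * z ^+ k @[k --> \oo] --> (0 : R).
Proof.
case/andP => z0 z1; have c0 : 0 < 1 - z by rewrite subr_gt0.
set c := 1 - z in c0; pose K := (n.+1)`!%:R / c ^+ n.+1.
have K0 : 0 < K by rewrite divr_gt0 ?ltr0n ?fact_gt0 ?exprn_gt0.
apply: (@squeeze_cvgr _ _ _ _ (fun=> 0) (fun k => 2 * K * harmonic k)).
- near=> k; rewrite mulr_ge0 ?exprn_ge0 //=.
  have k0 : (0 < k)%N by near: k; exists 1%N.
  have k0' : 0 < k%:R :> R by rewrite ltr0n.
  have zk : z ^+ k <= expR (- (k%:R * c)).
    apply: exprn_le_expR => //.
    by rewrite mulrAC divff ?mul1r ?gt_eqF // /c subKr.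
  have ec : (k%:R * c) ^+ n.+1 / (n.+1)`!%:R <= expR (k%:R * c).
    have kc0 : 0 <= k%:R * c by rewrite mulr_ge0 // ltW.
    by apply: le_trans (expR_ge1Dxn n kc0); rewrite lerDr.
  have kzK : k%:R ^+ n * z ^+ k <= K / k%:R.
    apply: (@le_trans _ _ (k%:R ^+ n * ((k%:R * c) ^+ n.+1 / (n.+1)`!%:R)^-1)).
      rewrite ler_wpM2l ?exprn_ge0 //; apply: le_trans zk _.
      rewrite expRN lef_pV2 ?posrE ?expR_gt0 //.
      by rewrite divr_gt0 ?ltr0n ?fact_gt0 ?exprn_gt0 ?mulr_gt0.
    rewrite le_eqVlt; apply/orP; left; apply/eqP.
    rewrite /K exprMn exprSr; field.
    by rewrite !gt_eqF ?ltr0n ?fact_gt0 ?exprn_gt0.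
  apply: le_trans kzK _.
  rewrite [2 * K]mulrC -[leRHS]mulrA ler_wpM2l ?(ltW K0) //.
  rewrite /harmonic /= ler_pdivlMr ?ltr0n // mulrC ler_pdivrMr //.
  by rewrite -natrM ler_nat; lia.
- exact: cvg_cst.
- rewrite -[X in _ --> X](mulr0 (2 * K)); apply: cvgMr; exact: cvg_harmonic.
Unshelve. all: by end_near.
Qed.

(** Trading [p^(k-1)] for [p^k] costs a factor [1 / p]: this is at most [2] when
    [p >= 1/2], and otherwise [p^(k-1)] is itself exponentially small. *)
Lemma ratio_sqr_le (R : realType) (p : R) k : 0 <= p -> (0 < k)%N ->
  k%:R ^+ 4 * p ^+ k.-1 <= 2 * (k%:R ^+ 5 * p ^+ k + k%:R ^+ 5 * 2^-1 ^+ k).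
Proof.
case: k => // k p0 _ /=; set m := k.+1%:R.
have m1 : 1 <= m :> R by rewrite ler1n.
have m4 : 0 <= m ^+ 4 by rewrite exprn_ge0.
have m45 : m ^+ 4 <= m ^+ 5 by rewrite ler_weXn2l.
have pk0 : 0 <= p ^+ k by rewrite exprn_ge0.
have h0 : 0 <= 2^-1 ^+ k :> R by rewrite exprn_ge0 // invr_ge0.
have key : p ^+ k <= 2 * (p ^+ k.+1 + 2^-1 ^+ k.+1).
  rewrite !exprSr; case: (lerP 2^-1 p) => hp; first by nra.
  have : p ^+ k <= 2^-1 ^+ k by rewrite lerXn2r ?nnegrE ?invr_ge0 // ltW.
  by nra.
by rewrite -mulrDr mulrCA; apply: ler_pM.
Qed.

Section Asymptotics.
Context (R : realType) (p : nat -> R).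
Hypothesis p01 : forall k, 0 <= p k < 1.
Hypothesis p_small : k%:R ^+ 5 * p k ^+ k @[k --> \oo] --> (0 : R).

(** The bound of [ratio_sqr_le] applies to the square of this sequence. *)
Lemma cvg_ratio0 :
  k%:R ^+ 2 * Num.sqrt (p k) ^+ k.-1 @[k --> \oo] --> (0 : R).
Proof.
have -> : (fun k => k%:R ^+ 2 * Num.sqrt (p k) ^+ k.-1) =
    (fun k => Num.sqrt (k%:R ^+ 4 * p k ^+ k.-1)).
  apply/funext => k; have /andP[p0 _] := p01 k.
  have e : (k%:R ^+ 2 * Num.sqrt (p k) ^+ k.-1) ^+ 2 = k%:R ^+ 4 * p k ^+ k.-1.
    by rewrite exprMn -exprM exprAC sqr_sqrtr.
  by rewrite -e sqrtr_sqr ger0_norm // mulr_ge0 ?exprn_ge0 ?sqrtr_ge0.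
rewrite -[X in _ --> X](@sqrtr0 R).
apply: (@cvg_comp _ _ _ (fun k => k%:R ^+ 4 * p k ^+ k.-1) Num.sqrt _
    (nbhs (0 : R)));
  last exact: sqrt_continuous.
apply: (@squeeze_cvgr _ _ _ _ (fun=> 0)
  (fun k => 2 * (k%:R ^+ 5 * p k ^+ k + k%:R ^+ 5 * 2^-1 ^+ k))).
- near=> k; have /andP[p0 _] := p01 k.
  rewrite mulr_ge0 ?exprn_ge0 //=; apply: ratio_sqr_le => //.
  by near: k; exists 1%N.
- exact: cvg_cst.
- rewrite -[X in _ --> X](mulr0 2); apply: cvgMr.
  rewrite -[X in _ --> X](addr0 0); apply: cvgD => //.
  by apply: cvg_natX_exprn0; lra.
Unshelve. all: by end_near.
Qed.

Context (d : nat -> measure_display) (T : forall k, measurableType (d k))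
    (P : forall k, probability (T k) R) (A : forall k, T k -> 'M[bool]_k).
Arguments A : clear implicits.

Lemma asymptotics_of_cvg :
  (forall k, random_binary_mx (P k) (p k) (A k)) ->
  permanent_zero_asymptotics P A p.
Proof.
move=> randA.
pose f k := fine (P k (per0_event R (A k))).
pose m k := 2 * k%:R * p k ^+ k.
pose x k := k%:R ^+ 2 * Num.sqrt (p k) ^+ k.-1.
have x_cvg : x k @[k --> \oo] --> 0 := cvg_ratio0.
have half0 : 0 < 2^-1 :> R by rewrite invr_gt0.
have approx : \forall k \near \oo, `|f k - m k| <= m k * (2 * x k).
  near=> k; have /andP[p0 /ltW p1] := p01 k.
  apply: (prob_per0_approx (randA k) p0 p1); first by near: k; exists 2%N.
  by near: k; apply: cvgr_le x_cvg _ half0.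
have m_ge0 k : 0 <= m k.
  by have /andP[p0 _] := p01 k; rewrite /m !mulr_ge0 ?exprn_ge0.
(* Where [p k = 0] the main term vanishes, and so does the probability by
   [approx]; the quotient would give the error term the junk value -1. *)
exists (fun k => if m k == 0 then 0 else f k / m k - 1); split.
  apply: (@squeeze_cvgr _ _ _ _ (fun k => - (2 * x k)) (fun k => 2 * x k)).
  - near=> k.
    have : `|f k - m k| <= m k * (2 * x k) by near: k.
    have x0 : 0 <= x k by rewrite /x mulr_ge0 ?exprn_ge0 ?sqrtr_ge0.
    have [_ _|mk] := eqVneq (m k) 0; first by lra.
    have m0 : 0 < m k by rewrite lt_neqAle eq_sym mk m_ge0.
    have -> : f k / m k - 1 = (f k - m k) / m k by rewrite mulrBl divff.
    by rewrite -ler_norml normrM normfV (gtr0_norm m0) ler_pdivrMr // mulrC.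
  - rewrite -oppr0; apply: cvgN.
    by rewrite -[X in _ --> X](mulr0 2); apply: cvgMr.
  - by rewrite -[X in _ --> X](mulr0 2); apply: cvgMr.
near=> k; rewrite -/(per0_event R (A k)).
have fP : P k (per0_event R (A k)) \is a fin_num.
  by apply: fin_num_measure; exact: (measurable_per0_event (randA k)).
rewrite -(fineK fP); congr (_%:E); rewrite -/(f k) -/(m k).
have : `|f k - m k| <= m k * (2 * x k) by near: k.
have [->|mk _] := eqVneq (m k) 0; last by rewrite addrC subrK mulrC divfK.
by rewrite !mul0r subr0 normr_le0 => /eqP.
Unshelve. all: by end_near.
Qed.
End Asymptotics.

Theorem theorem27 (R : realType)
    (d : nat -> measure_display) (T : forall k, measurableType (d k))
    (P : forall k, probability (T k) R) (A : forall k, T k -> 'M[bool]_k) :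
  (forall p : R, 0 <= p < 1 ->
     (forall k, random_binary_mx (P k) p (A k)) ->
     permanent_zero_asymptotics P A (fun=> p))
  /\
  (forall p : nat -> R, (forall k, 0 <= p k < 1) ->
     (forall k, random_binary_mx (P k) (p k) (A k)) ->
     k%:R ^+ 5 * p k ^+ k @[k --> \oo] --> (0 : R) ->
     permanent_zero_asymptotics P A p)
  /\
  (forall p : nat -> R, (forall k, 0 <= p k < 1) ->
     (forall k, random_binary_mx (P k) (p k) (A k)) ->
     forall omega : nat -> R, omega k @[k --> \oo] --> +oo ->
     (\forall k \near \oo, p k <= 1 - (5 * ln k%:R + omega k) / k%:R) ->
     permanent_zero_asymptotics P A p).
Proof.
split; [|split].
- move=> p p01 randA; apply: (asymptotics_of_cvg (fun=> p01) _ randA).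
  exact: cvg_natX_exprn0.
- by move=> p p01 randA p_small; apply: asymptotics_of_cvg.
move=> p p01 randA omega omega_oo p_le.
apply: (asymptotics_of_cvg p01 _ randA).
apply: (@squeeze_cvgr _ _ _ _ (fun=> 0) (fun k => expR (- omega k))).
- near=> k; have /andP[p0 _] := p01 k; rewrite mulr_ge0 ?exprn_ge0 //=.
  have k0 : (0 < k)%N by near: k; exists 1%N.
  have k0' : 0 < k%:R :> R by rewrite ltr0n.
  have : p k ^+ k <= expR (- (5 * ln k%:R + omega k)).
    by apply: exprn_le_expR => //; near: k.
  rewrite opprD expRD [expR (- (5 * _))]expRN (expRM_natl 5) lnK ?posrE //.
  by rewrite ler_pdivlMl ?exprn_gt0.
- exact: cvg_cst.
- apply: (@cvg_comp _ _ _ omega (fun y => expR (- y)) _ _ _ omega_oo).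
  exact: cvgr_expR.
Unshelve. all: by end_near.
Qed.
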